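(* Let $p$ be an odd prime and let $f:\mathbb{F}_{p^2}\to\mathbb{F}_{p^2}$ be a planar function which is homogeneous, i.e., there is a fixed positive integer $d$ such that $f(\lambda x)=\lambda^d f(x)$ for all $\lambda\in\mathbb{F}_p$ and $x\in\mathbb{F}_{p^2}$. Then $f$ is equivalent to $x\mapsto x^2$.
   Context: A function $f:\mathbb{F}_q\to\mathbb{F}_q$ ($q$ a power of the odd prime $p$) is planar if for every $a\in\mathbb{F}_q^*$ the map $x\mapsto f(x+a)-f(x)-f(a)$ is a permutation of $\mathbb{F}_q$. Two planar functions $f_1,f_2$ on $\mathbb{F}_q$ are equivalent if there are linearized (i.e. $\mathbb{F}_p$-linear) permutation polynomials $L_1,L_2$, a linearized polynomial $L_3$ and a constant $c\in\mathbb{F}_q$ such that $f_2(x)=L_2(f_1(L_1(x)))+L_3(x)+c$ for all $x$. *)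

(* Defs.v *)
From mathcomp Require Import all_boot all_order all_algebra all_field.

Set Implicit Arguments.
Unset Strict Implicit.
Unset Printing Implicit Defensive.

Import GRing.Theory.
Local Open Scope ring_scope.

Definition planar (F : finFieldType) (f : F -> F) : Prop :=
  forall a : F, a != 0 -> bijective (fun x => f (x + a) - f x - f a).

(* [p] is meant to be the characteristic of [F]; [(lam : nat)%:R] is then the
   image of [lam : 'F_p] in the prime subfield of [F]. *)
Definition homogeneous (p : nat) (F : finFieldType) (f : F -> F) : Prop :=
  exists d : nat, (0 < d)%N /\
    forall (lam : 'F_p) (x : F),
      f ((lam : nat)%:R * x) = ((lam : nat)%:R) ^+ d * f x.

(* [p] is meant to be the characteristic of [F]. *)
Definition linearized (p : nat) (F : finFieldType) (L : {poly F}) : Prop :=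
  exists (n : nat) (a : 'I_n -> F), L = \sum_(i < n) a i *: 'X^(p ^ i).

Definition permutation_poly (F : finFieldType) (L : {poly F}) : Prop :=
  bijective (fun x : F => L.[x]).

Definition planar_equivalent (p : nat) (F : finFieldType) (f1 f2 : F -> F) :
    Prop :=
  exists (L1 L2 L3 : {poly F}) (c : F),
    [/\ linearized p L1 /\ permutation_poly L1,
        linearized p L2 /\ permutation_poly L2,
        linearized p L3
      & forall x : F, f2 x = L2.[f1 L1.[x]] + L3.[x] + c].

(* Main.v *)
Require Import Defs.
From HB Require Import structures.
From mathcomp Require Import all_boot all_order all_algebra all_field.
From mathcomp Require Import zify ring.

Set Implicit Arguments.
Unset Strict Implicit.
Unset Printing Implicit Defensive.

Import GRing.Theory.
Local Open Scope ring_scope.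

(* Planarity makes every function h(x) = Tr(a f(x) + b x), a <> 0, bent: the
   character sum S = sum_x z^h(x), z a primitive p-th root of unity, satisfies
   S S^* = p^2, so S is divisible by (z - 1)^(p-1), that is by p.  Expanding S
   in powers of z - 1 shows that the power sums sum_x h(x)^k vanish in F_p for
   k < p - 1.  The same argument on F_p, applied to x |-> x^d, which is planar
   there because f is homogeneous, forces d = 2 modulo p - 1.  On F_{p^2}, the
   vanishing for k = p - 2 kills the moments sum_x f(x) x^k with
   k = p - 3 modulo p - 1, except for three of them, and homogeneity kills the
   other residues; interpolation then gives f(x) = a x^2 + b x^(p+1) + c x^(2p).
   Finally the polarization of f defines a commutative division algebra of
   dimension 2 over F_p, with identity after an isotopy; it is generated by one
   element, hence isomorphic to F_{p^2}, and f becomes the squaring map. *)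

(** * Power sums of bent functions *)

Lemma prim_root_neq1 (R : nzRingType) (p : nat) (z : R) :
  prime p -> p.-primitive_root z -> z != 1.
Proof.
move=> p_pr z_prim; apply/eqP=> z1.
have := prim_order_dvd z_prim 1; rewrite expr1 z1 eqxx.
by rewrite dvdn1 => /eqP p1; rewrite p1 in p_pr.
Qed.

(** Evaluate 1 + X + ... + X^(p-1), the product of the X - z^i for 0 < i < p, at 1: each factor 1 -
    z^i is z - 1 times an algebraic integer. *)
Lemma pred_exp_dvd_prime (p : nat) (z : algC) :
    prime p -> p.-primitive_root z ->
  exists2 u, u \in Aint & p%:R = (z - 1) ^+ p.-1 * u.
Proof.
move=> p_pr z_prim; have zA := Aint_prim_root z_prim.
have p_gt0 := prime_gt0 p_pr.
have: \prod_(1 <= i < p) ('X - (z ^+ i)%:P) = \sum_(i < p) 'X^i :> {poly algC}.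
  have /mulfI : 'X - 1 != 0 :> {poly algC} by rewrite -polyC1 polyXsubC_eq0.
  apply; rewrite -subrX1 -(factor_Xn_sub_1 z_prim).
  by rewrite [RHS]big_ltn // expr0.
move/(congr1 (horner_eval 1)); rewrite rmorph_prod /= rmorph_sum /=.
rewrite [X in _ = X -> _](eq_bigr (fun=> 1)); last first.
  by move=> i _; rewrite horner_evalE hornerXn expr1n.
rewrite sumr_const card_ord => <-.
exists (\prod_(1 <= i < p) - \sum_(j < i) z ^+ j).
  apply: rpred_prod => i _; rewrite rpredN; apply: rpred_sum => j _.
  exact: rpredX.
rewrite -[in X in _ ^+ X](subn1 p) -prodr_const_nat -big_split /=.
by apply: eq_bigr => i _; rewrite horner_evalE !hornerE mulrN -subrX1 opprB.
Qed.

(** The extreme terms of the binomial expansion cancel, since z^p = 1 and p is odd; p divides all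
    the others. *)
Lemma prime_dvd_pred_exp (p : nat) (z : algC) :
    prime p -> p.-primitive_root z -> odd p ->
  exists2 u, u \in Aint & (z - 1) ^+ p = p%:R * u.
Proof.
move=> p_pr z_prim p_odd; have zA := Aint_prim_root z_prim.
have p_gt0 := prime_gt0 p_pr.
have mA : -1 \in Aint by rewrite rpredN rpred1.
exists (\sum_(1 <= i < p) z ^+ (p - i) * (-1) ^+ i *+ ('C(p, i) %/ p)).
  by apply: rpred_sum => i _; rewrite rpredMn // rpredM // rpredX.
rewrite exprDn.
rewrite -(big_mkord xpredT (fun i => z ^+ (p - i) * (-1) ^+ i *+ 'C(p, i))).
rewrite big_ltn // big_nat_recr //= subn0 subnn bin0 binn !mulr1n !expr0.
rewrite (prim_expr_order z_prim) -signr_odd p_odd !mulr1 mul1r expr1.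
rewrite addrCA subrr addr0 mulr_sumr; apply: eq_big_nat => i /andP[i0 ip].
have p_dvd : (p %| 'C(p, i))%N by rewrite prime_dvd_bin ?i0.
by rewrite mulrnAr mulr_natl -mulrnA mulnC divnK.
Qed.

(** Expand z^g as (1 + (z - 1))^g. The terms of index below k carry a factor p, hence (z - 1)^(p-1)
    with p - 1 > k, and go into the error term [t]. *)
Lemma sum_unity_expansion (T : finType) (g : T -> nat) (p k : nat) (z : algC) :
    prime p -> p.-primitive_root z -> (k < p.-1)%N ->
    (forall j, (j < k)%N -> p %| \sum_x 'C(g x, j))%N ->
  exists2 t, t \in Aint
    & \sum_x z ^+ g x = (z - 1) ^+ k * ((\sum_x 'C(g x, k))%:R + (z - 1) * t).
Proof.
move=> p_pr z_prim lt_kp dvd_lt_k; have zA := Aint_prim_root z_prim.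
have z1A : z - 1 \in Aint by rewrite rpredB ?rpred1.
have [u uA p_u] := pred_exp_dvd_prime p_pr z_prim.
pose c j := (\sum_x 'C(g x, j))%N.
pose B := (k + \max_x g x).+1.
have expand_z : \sum_x z ^+ g x = \sum_(j < B) (z - 1) ^+ j *+ c j.
  transitivity (\sum_x \sum_(j < B) (z - 1) ^+ j *+ 'C(g x, j)).
    apply: eq_bigr => x _; rewrite -{1}[z](subrK 1) exprD1n.
    have le_gB : ((g x).+1 <= B)%N
      by rewrite ltnS (leq_trans (leq_bigmax x)) ?leq_addl.
    rewrite (big_ord_widen _ (fun j => (z - 1) ^+ j *+ 'C(g x, j)) le_gB).
    rewrite big_mkcond; apply: eq_bigr => j _.
    by case: ltnP => // lt_gj; rewrite bin_small // mulr0n.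
  by rewrite exchange_big; apply: eq_bigr => j _; rewrite sumrMnr.
pose t1 := \sum_(j < k) (z - 1) ^+ (j + (p.-1 - k.+1)) * u *+ (c j %/ p).
pose t2 := \sum_(k.+1 <= j < B) (z - 1) ^+ (j - k.+1) *+ c j.
exists (t1 + t2).
  rewrite rpredD // rpred_sum // => i _; last by rewrite rpredMn // rpredX.
  by rewrite rpredMn // rpredM // rpredX.
rewrite expand_z -(big_mkord xpredT (fun j => (z - 1) ^+ j *+ c j)).
rewrite (big_cat_nat (leq0n k)) /=; last by rewrite /B; lia.
rewrite big_mkord [X in _ + X]big_ltn; last by rewrite /B; lia.
rewrite mulrDr mulr_natr addrCA; congr (_ + _).
rewrite mulrA -exprSr mulrDr !mulr_sumr; congr (_ + _).
  apply: eq_bigr => j _; have lt_jk := ltn_ord j.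
  have c_p : c j = (c j %/ p * p)%N by rewrite divnK ?dvd_lt_k.
  rewrite [in LHS]c_p mulnC mulrnA -[_ *+ p]mulr_natr p_u mulrnAr;
    congr (_ *+ _).
  by rewrite !mulrA -!exprD; congr (_ ^+ _ * _); lia.
by apply: eq_big_nat => j /andP[lt_kj _]; rewrite mulrnAr -exprD subnKC.
Qed.

Lemma Fp_expD (R : nzRingType) (p : nat) (z : R) (a b : 'F_p) :
  prime p -> p.-primitive_root z -> z ^+ (a + b)%R = z ^+ a * z ^+ b.
Proof.
move=> p_pr z_prim; have -> : (a + b)%R = (a + b)%N%:R :> 'F_p.
  by rewrite natrD !natr_Zp.
by rewrite val_Fp_nat // prim_expr_mod // exprD.
Qed.

(** Translation by y multiplies the sum by z^(t y), which is not 1. *)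
Lemma sum_unity_additive (V : finZmodType) (p : nat) (t : V -> 'F_p) (y : V)
    (z : algC) :
    prime p -> p.-primitive_root z -> {morph t : u v / u + v} -> t y != 0 ->
  \sum_v z ^+ t v = 0.
Proof.
move=> p_pr z_prim tD ty0.
have shift : \sum_v z ^+ t v = z ^+ t y * \sum_v z ^+ t v.
  rewrite {1}(reindex_inj (addrI y)) mulr_sumr; apply: eq_bigr => v _.
  by rewrite tD Fp_expD.
have z_neq1 : z ^+ t y != 1.
  rewrite -(prim_order_dvd z_prim) gtnNdvd ?lt0n //.
  by rewrite -[X in (_ < X)%N](Fp_cast p_pr) ltn_ord.
move/eqP: shift; rewrite -subr_eq0 -{1}[X in X - _]mul1r -mulrBl mulf_eq0.
by rewrite subr_eq0 eq_sym (negPf z_neq1) => /eqP.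
Qed.

(** Bentness is expressed by derivatives instead of absolute values of Walsh coefficients: this is
    the form that planarity yields directly. *)
Definition bent (V : finZmodType) (p : nat) (h : V -> 'F_p) : Prop :=
  forall (z : algC) (a : V), p.-primitive_root z -> a != 0 ->
  \sum_x z ^+ (h (x + a) - h x)%R = 0.

(** Group the double sum by differences: only the difference 0 survives. Since z^-1 is the complex
    conjugate of z, this is S S^*. *)
Lemma bent_sum_norm (V : finZmodType) (p : nat) (h : V -> 'F_p) (z : algC) :
    prime p -> p.-primitive_root z -> bent h ->
  (\sum_x z ^+ h x) * (\sum_x z^-1 ^+ h x) = #|V|%:R.
Proof.
move=> p_pr z_prim h_bent.
have z_unit : z \is a GRing.unit.
  by rewrite unitfE (prim_root_eq0 z_prim) -lt0n prime_gt0.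
have quot (a b : 'F_p) : z ^+ (a - b)%R = z ^+ a * z^-1 ^+ b :> algC.
  have := Fp_expD (a - b) b p_pr z_prim; rewrite subrK => ->.
  by rewrite -mulrA exprVn mulrV ?unitrX ?mulr1.
transitivity (\sum_a \sum_x z ^+ (h (x + a) - h x)%R).
  rewrite exchange_big mulrC mulr_suml; apply: eq_bigr => x _.
  rewrite (reindex_inj (addrI x)) mulr_sumr; apply: eq_bigr => a _.
  by rewrite quot mulrC.
rewrite (bigD1 0) //= [X in _ + X]big1 => [|a a0]; last exact: h_bent.
rewrite addr0 (eq_bigr (fun=> 1)) => [|x _].
  by rewrite sumr_const.
by rewrite quot addr0 -exprMn mulrV ?expr1n.
Qed.

(* If p divides the first k coefficients of S in its expansion in powers of
   z - 1, then S S^* = #|V| = p^n forces the square of the k-th one to be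
   divisible by z - 1: p has valuation p - 1 at z - 1. *)
Lemma dvd_binomial_sum (V : finZmodType) (p n k : nat) (h : V -> 'F_p) :
    prime p -> odd p -> #|V| = (p ^ n)%N -> bent h ->
    (k < p.-1)%N -> (k.*2 < n * p.-1)%N ->
  (p %| \sum_x 'C(h x, k))%N.
Proof.
move=> p_pr p_odd cardV h_bent; elim/ltn_ind: k => k IHk lt_kp lt_k_np.
have [z z_prim] := C_prim_root_exists (prime_gt0 p_pr).
have zA := Aint_prim_root z_prim.
have z0 : z != 0 by rewrite (prim_root_eq0 z_prim) -lt0n prime_gt0.
have w_prim : p.-primitive_root z^-1.
  have -> : z^-1 = z ^+ p.-1.
    apply: (mulfI z0); rewrite mulfV // -exprS prednK ?prime_gt0 //.
    by rewrite prim_expr_order.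
  by rewrite prim_root_exp_coprime // coprime_sym coprimenP ?prime_gt0.
have wA := Aint_prim_root w_prim.
have dvd_lt j : (j < k)%N -> (p %| \sum_x 'C(h x, j))%N.
  by move=> lt_jk; apply: IHk => //; lia.
have := bent_sum_norm p_pr z_prim h_bent; rewrite cardV.
have [t tA ->] := sum_unity_expansion p_pr z_prim lt_kp dvd_lt.
have [t' tA' ->] := sum_unity_expansion p_pr w_prim lt_kp dvd_lt.
have [u uA p_u] := pred_exp_dvd_prime p_pr z_prim.
have [u' uA' pi_u'] := prime_dvd_pred_exp p_pr z_prim p_odd.
set c := (\sum_x 'C(h x, k))%N; set pi := z - 1 in p_u pi_u' *.
have piA : pi \in Aint by rewrite rpredB ?rpred1.
have pi0 : pi != 0 by rewrite subr_eq0 (prim_root_neq1 p_pr).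
have -> : z^-1 - 1 = - z^-1 * pi by rewrite mulrBr mulNr mulVf // mulr1; ring.
have [m def_m] : exists m, (n * p.-1 = k.*2 + m.+1)%N.
  by exists (n * p.-1 - k.*2.+1)%N; rewrite addnS -addSn subnKC.
rewrite natrX p_u [in RHS]exprMn -exprM [(_ * n)%N]mulnC def_m => norm_eq.
have [r rA c_r] : exists2 r, r \in Aint & c%:R ^+ 2 = pi * r.
  exists ((- z) ^+ k * pi ^+ m * u ^+ n
    - (c%:R * (t + - z^-1 * t') + pi * - z^-1 * t * t')).
    rewrite rpredB ?rpredD // ?rpredM ?rpredX ?rpredN ?rpred_nat //.
    by rewrite rpredD // rpredM ?rpredN.
  have: pi ^+ k.*2 != 0 by rewrite expf_neq0.
  move/mulfI; apply.
  have zz : (- z) ^+ k * (- z^-1) ^+ k = 1.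
    by rewrite -exprMn mulrNN divff // expr1n.
  move: norm_eq zz; rewrite exprD exprSr
    -muln2 exprM [(- z^-1 * pi) ^+ k]exprMn.
  move: (pi ^+ k) ((- z) ^+ k) (- z^-1) ((- z^-1) ^+ k) => P zk v wk norm_eq zz.
  have -> : P ^+ 2 * c%:R ^+ 2 = zk * (P * (c%:R + pi * t)
      * (wk * P * (c%:R + v * pi * t')))
      - P ^+ 2 * (pi * (c%:R * (t + v * t') + pi * v * t * t')).
    transitivity (zk * wk * (P ^+ 2 * (c%:R + pi * t) * (c%:R + v * pi * t'))
      - P ^+ 2 * (pi * (c%:R * (t + v * t') + pi * v * t * t'))); last by ring.
    by rewrite zz; ring.
  by rewrite norm_eq; ring.
(* As p divides pi^p, the p-th power trades [pi] for p, and divisibility descends to the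
   integers. *)
have: (p%:R %| (c ^ (2 * p))%:R)%A.
  rewrite -eqAmod0 natrX exprM c_r exprMn pi_u' -mulrA.
  by rewrite eqAmodMr0 ?rpredM ?rpredX.
by rewrite -eqAmod0 eqAmod0_nat Euclid_dvdX // => /andP[].
Qed.

(** Multiplied by j!, binomials become falling factorials. Powers are recovered from a * falling j a
    = falling (j+1) a + j * falling j a, so the induction runs over mixed products. *)
Lemma bent_power_sum (V : finZmodType) (p n k : nat) (h : V -> 'F_p) :
    prime p -> odd p -> #|V| = (p ^ n)%N -> bent h ->
    (k < p.-1)%N -> (k.*2 < n * p.-1)%N ->
  \sum_x h x ^+ k = 0.
Proof.
move=> p_pr p_odd cardV h_bent lt_kp lt_k_np.
pose falling (j : nat) (a : 'F_p) := \prod_(i < j) (a - i%:R).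
have natr_falling j (m : nat) : (m ^_ j)%:R = falling j m%:R.
  rewrite /falling; elim: j => [|j IHj]; first by rewrite big_ord0.
  rewrite big_ord_recr ffactnSr natrM IHj /=.
  have [le_jm|lt_mj] := leqP j m; first by rewrite natrB.
  by rewrite -IHj ffact_small // !mul0r.
suff sum0 m j : (j + m <= k)%N -> \sum_x falling j (h x) * h x ^+ m = 0.
  rewrite -[RHS](sum0 k 0 (leqnn k)); apply: eq_bigr => x _.
  by rewrite /falling big_ord0 mul1r.
elim: m j => [|m IHm] j; last first.
  rewrite addnS => lt_k; transitivity (\sum_x (falling j.+1 (h x) * h x ^+ m
      + j%:R * (falling j (h x) * h x ^+ m))).
    apply: eq_bigr => x _; rewrite /falling big_ord_recr /= exprS; ring.
  by rewrite big_split /= -mulr_sumr !IHm ?mulr0 ?addr0 // ltnW.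
rewrite addn0 => le_jk.
have := @dvd_binomial_sum V p n j h p_pr p_odd cardV h_bent.
move=> /(_ _ _)/dvdnP[]; [lia | lia | move=> q def_q].
transitivity ((\sum_x 'C(h x, j))%N%:R * j`!%:R : 'F_p); last first.
  by rewrite def_q natrM pchar_Fp_0 // mulr0 mul0r.
rewrite natr_sum mulr_suml; apply: eq_bigr => x _.
by rewrite expr0 mulr1 -natrM bin_ffact natr_falling natr_Zp.
Qed.

(** * Planar monomials on the prime field *)

Lemma poly_vanish_finField (R : finFieldType) (P : {poly R}) :
  (size P <= #|R|)%N -> (forall x, P.[x] = 0) -> P = 0.
Proof.
move=> szP P0; apply/eqP; apply: contraTT szP => nzP; rewrite -ltnNge.
rewrite cardE; apply: max_poly_roots nzP _ (enum_uniq _).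
by apply/allP=> x _; apply/rootP.
Qed.

Lemma size_XnsubX (R : nzRingType) (n : nat) :
  (1 < n)%N -> size ('X^n - 'X : {poly R}) = n.+1.
Proof.
by move=> n_gt1; rewrite size_polyDl size_polyXn // size_polyN size_polyX.
Qed.

Lemma natr_Fp_neq0 (p m : nat) : prime p -> (0 < m < p)%N -> m%:R != 0 :> 'F_p.
Proof.
move=> p_pr /andP[m0 mp]; rewrite -(dvdn_pcharf (pchar_Fp p_pr)).
by rewrite gtnNdvd.
Qed.

Lemma natr_bin_Fp_neq0 (p k i : nat) :
  prime p -> (k < p)%N -> (i <= k)%N -> 'C(k, i)%:R != 0 :> 'F_p.
Proof.
move=> p_pr kp ik; rewrite -(dvdn_pcharf (pchar_Fp p_pr)).
apply: contraL kp => p_dvd; rewrite -leqNgt.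
have: (p %| k`!)%N by rewrite -(bin_fact ik) dvdn_mulr.
elim: (k) => [|m IHm].
  by rewrite fact0 dvdn1 => /eqP p1; rewrite p1 in p_pr.
rewrite factS Euclid_dvdM // => /orP[/dvdn_leq->|/IHm/leqW] //.
Qed.

(** The hypothesis is a polynomial in b of degree at most k < p vanishing on all of F_p, so its
    coefficients vanish; the binomial factor is invertible. *)
Lemma mixed_power_sum (T : finType) (p k i : nat) (u w : T -> 'F_p) :
    prime p -> (k < p)%N -> (i <= k)%N ->
    (forall b : 'F_p, \sum_x (u x + b * w x) ^+ k = 0) ->
  \sum_x u x ^+ (k - i) * w x ^+ i = 0.
Proof.
move=> p_pr kp ik sum0.
pose c j := 'C(k, j)%:R * \sum_x u x ^+ (k - j) * w x ^+ j.
have: \poly_(j < k.+1) c j = 0.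
  apply: poly_vanish_finField => [|b].
    by rewrite card_Fp // (leq_trans (size_poly _ _)).
  rewrite horner_poly -[RHS](sum0 b) (eq_bigr (fun x => \sum_(j < k.+1)
     (u x ^+ (k - j) * (b * w x) ^+ j *+ 'C(k, j)))) => [|x _]; last first.
    exact: exprDn.
  rewrite exchange_big; apply: eq_bigr => j _.
  rewrite /c mulrAC mulr_sumr; apply: eq_bigr => x _;
    rewrite -mulr_natl exprMn; ring.
move/(congr1 (coefp i)) => /eqP; rewrite /= coef_poly coef0 ltnS ik mulf_eq0.
by rewrite (negPf (natr_bin_Fp_neq0 p_pr kp ik)) => /eqP.
Qed.

Lemma Fp_expp (p : nat) (x : 'F_p) : prime p -> x ^+ p = x.
Proof. by move=> p_pr; have := expf_card x; rewrite card_Fp. Qed.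

Lemma Fp_expN1 (p : nat) (x : 'F_p) : prime p -> x != 0 -> x ^+ p.-1 = 1.
Proof.
move=> p_pr x0; apply: (mulfI x0).
by rewrite -exprS prednK ?prime_gt0 // mulr1 Fp_expp.
Qed.

Lemma Fp_power_sum (p e : nat) :
  prime p -> (0 < e)%N -> (p.-1 %| e)%N -> \sum_(x : 'F_p) x ^+ e = -1.
Proof.
move=> p_pr e0 /dvdnP[q def_e].
rewrite (bigD1 0) //= expr0n eqn0Ngt e0 add0r.
rewrite (eq_bigr (fun=> 1)) => [|x x0]; last first.
  by rewrite def_e mulnC exprM Fp_expN1 // expr1n.
rewrite sumr_const cardC1 card_Fp // -subn1 natrB ?prime_gt0 //.
by rewrite pchar_Fp_0 // sub0r.
Qed.

(** Each x^d + b x is bent on F_p, so the sum of x^(di+j) vanishes when 2(i+j) < p - 1; but it is -1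
    if p - 1 divides di + j > 0. Suitable i and j exclude all residues of d except 2 and (p+1)/2. *)
Lemma planar_monomial_Fp (p d : nat) :
    prime p -> odd p -> (0 < d)%N ->
    injective (fun x : 'F_p => (x + 1) ^+ d - x ^+ d) ->
  d = 2 %[mod p.-1].
Proof.
move=> p_pr p_odd d0 D_inj; have p_gt0 := prime_gt0 p_pr.
have p_gt2 := odd_prime_gt2 p_odd p_pr.
have D_neq (x y : 'F_p) : x - y != 0 ->
    (x + 1) ^+ d - x ^+ d <> (y + 1) ^+ d - y ^+ d.
  by rewrite subr_eq0 => /eqP x_neq_y /D_inj.
have D_inj_a (a : 'F_p) : a != 0 -> injective (fun x => (x + a) ^+ d - x ^+ d).
  move=> a0.
  have scale x : ((x / a + 1) ^+ d - (x / a) ^+ d) * a ^+ d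
      = (x + a) ^+ d - x ^+ d.
    by rewrite mulrBl -!exprMn mulrDl divfK // mul1r.
  move=> x y eq_xy; apply: (divIf a0); apply: D_inj => /=.
  by apply: (mulIf (expf_neq0 d a0)); rewrite !scale.
have no_term i j : ((i + j).*2 < p.-1)%N -> (0 < d * i + j)%N ->
    ~~ (p.-1 %| d * i + j)%N.
  move=> ij gt0; apply/negP => /(Fp_power_sum p_pr gt0).
  suff -> : \sum_(x : 'F_p) x ^+ (d * i + j) = 0.
    by move/eqP; rewrite eq_sym oppr_eq0 oner_eq0.
  transitivity (\sum_(x : 'F_p) (x ^+ d) ^+ (i + j - j) * x ^+ j).
    by apply: eq_bigr => x _; rewrite addnK -exprM -exprD.
  apply: mixed_power_sum; [exact: p_pr | lia | exact: leq_addl | move=> b].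
  apply: (@bent_power_sum 'F_p p 1); rewrite ?card_Fp ?expn1 //; try lia.
  move=> z a z_prim a0.
  pose phi (x : 'F_p) := (x + a) ^+ d - x ^+ d + b * a.
  have phi_inj : injective phi by move=> x y /addIr/(D_inj_a a a0).
  rewrite (eq_bigr (fun x => z ^+ phi x)) => [|x _]; last first.
    by congr (z ^+ nat_of_ord _); rewrite /phi; ring.
  transitivity (\sum_(y : 'F_p) z ^+ y);
    first by rewrite [RHS](reindex_inj phi_inj).
  exact: (@sum_unity_additive _ _ id 1).
(* For odd d the difference function takes the value 1 at both 0 and -1. *)
have d_even : ~~ odd d.
  apply/negP=> d_odd; case: (@D_neq 0 (-1));
    first by rewrite opprK add0r oner_eq0.
  rewrite addNr expr0n (gtn_eqF d0) mulr0n.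
  by rewrite add0r -signr_odd d_odd expr1n expr1; ring.
pose e := (d %% p.-1)%N.
have def_d : (d = d %/ p.-1 * p.-1 + e)%N := divn_eq d p.-1.
have e_lt : (e < p.-1)%N by rewrite ltn_mod; lia.
have e_even : ~~ odd e by move: d_even; rewrite {1}def_d; lia.
have [e0|e_gt0] := posnP e.
  have [p3|p_neq3] := eqVneq p 3; first by rewrite -/e e0 p3.
  have /negP[] : ~~ (p.-1 %| d * 1 + 0)%N by apply: no_term; lia.
  by rewrite muln1 addn0 /dvdn -/e e0.
have [e2|e_neq2] := eqVneq e 2; first by rewrite -/e e2 modn_small //; lia.
have [lt_e|ge_e] := ltnP (p.-1.+2) e.*2.
  have /negP[] : ~~ (p.-1 %| d * 1 + (p.-1 - e))%N by apply: no_term; lia.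
  by rewrite muln1 {1}def_d -addnA subnKC ?(ltnW e_lt) // dvdn_addr ?dvdn_mull.
(* Here e >= 4. Dividing p - 1 = i e + r with i >= 2 gives (p - 1) - 2(i + r) = i(e - 2) - r > 0, so
   the pair (i, r) is admissible. *)
have [le_e|gt_e] := leqP e.*2 p.-1.
  have := no_term (p.-1 %/ e)%N (p.-1 %% e)%N.
  have := divn_eq p.-1 e; have := ltn_pmod p.-1 e_gt0.
  have : (2 <= p.-1 %/ e)%N by rewrite leq_divRL //; lia.
  move: (p.-1 %/ e)%N (p.-1 %% e)%N => i r i_ge2 r_lt def_p nt.
  have /negP[] : ~~ (p.-1 %| d * i + r)%N by apply: nt; nia.
  rewrite {1}def_d mulnDl -addnA [(e * i)%N]mulnC -def_p dvdn_addl //.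
  by rewrite mulnAC dvdn_mull.
(* The power sums say nothing when d = (p + 1) / 2 modulo p - 1, where
   x ^+ d = x * chi x with chi the quadratic character; there the values of
   the difference function at -1, 0, 1, 2 and 3 are compared. *)
pose M := p./2.
have def_p : p = M.*2.+1 by rewrite /M; lia.
have def_e : e = M.+1 by lia.
pose chi (x : 'F_p) := x ^+ M.
have xd x : x ^+ d = x * chi x.
  have [->|x0] := eqVneq x 0; first by rewrite mul0r expr0n eqn0Ngt d0.
  rewrite def_d exprD mulnC exprM Fp_expN1 // expr1n mul1r def_e exprS //.
have chi_sq x : x != 0 -> chi x ^+ 2 = 1.
  move=> x0; rewrite -exprM muln2 -[RHS](Fp_expN1 p_pr x0); congr (_ ^+ _); lia.
have chi1 x : x != 0 -> {chi x = 1} + {chi x = -1}.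
  move=> /chi_sq/eqP; rewrite sqrf_eq1; case: eqP => [|_ /eqP];
    by [left | right].
have nz2 : 2%:R != 0 :> 'F_p by apply: natr_Fp_neq0 => //; lia.
have nz3 : 3%:R != 0 :> 'F_p by apply: natr_Fp_neq0 => //; lia.
have D x : (x + 1) ^+ d - x ^+ d = (x + 1) * chi (x + 1) - x * chi x
  by rewrite !xd.
have chiM : chi 1 = 1 by rewrite /chi expr1n.
have [c2|c2] := chi1 _ nz2.
  case: (@D_neq 1 0); first by rewrite subr0 oner_eq0.
  rewrite !D add0r (_ : 1 + 1 = 2%:R :> 'F_p); last by ring.
  by rewrite c2 chiM; ring.
have [c3|c3] := chi1 _ nz3; last first.
  case: (@D_neq 2%:R (-1)); first by rewrite opprK natr1.
  rewrite !D addNr natr1 c2 c3.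
  have -> : chi (-1) = -1.
    (* M is odd because e = M + 1 is even. *)
    by rewrite /chi -signr_odd (_ : odd M) ?expr1 //; lia.
  by ring.
case: (@D_neq 3%:R 0); first by rewrite subr0.
rewrite !D add0r chiM c3.
have -> : 3%:R + 1 = 2%:R * 2%:R :> 'F_p by ring.
have -> : chi (2%:R * 2%:R) = 1.
  by rewrite /chi exprMn -[2%:R ^+ M]/(chi 2%:R) c2; ring.
by ring.
Qed.

(** * Moments and interpolation *)

(* The proof [pcharRp] occurs in no value of the map, but is what makes it a
   ring morphism, inferrable from the term. *)
Definition Fp_embed (R : nzRingType) (p : nat) (pcharRp : p \in [pchar R])
  (a : 'F_p) : R := (a : nat)%:R.

Section FpEmbed.

Variables (R : nzRingType) (p : nat).
Hypothesis pcharRp : p \in [pchar R].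

Local Notation iota := (Fp_embed pcharRp).

Let p_pr : prime p := pcharf_prime pcharRp.

Lemma Fp_embed_nat (m : nat) : iota m%:R = m%:R.
Proof. by rewrite /Fp_embed val_Fp_nat // (GRing.natr_mod_pchar pcharRp). Qed.

Fact Fp_embed_is_zmod_morphism : zmod_morphism iota.
Proof.
have iotaD : {morph iota : a b / a + b}.
  by move=> a b; rewrite -[a]natr_Zp -[b]natr_Zp -natrD !Fp_embed_nat natrD.
by move=> a b; apply: (addIr (iota b)); rewrite subrK -iotaD subrK.
Qed.

Fact Fp_embed_is_monoid_morphism : monoid_morphism iota.
Proof.
split=> [|a b]; first exact: (Fp_embed_nat 1).
by rewrite -[a]natr_Zp -[b]natr_Zp -natrM !Fp_embed_nat natrM.
Qed.

HB.instance Definition _ :=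
  GRing.isZmodMorphism.Build 'F_p R iota Fp_embed_is_zmod_morphism.
HB.instance Definition _ :=
  GRing.isMonoidMorphism.Build 'F_p R iota Fp_embed_is_monoid_morphism.

End FpEmbed.

(** The image of F_p already supplies the p roots that X^p - X can have. *)
Lemma Fp_embed_fixed (F : fieldType) (p : nat) (pcharFp : p \in [pchar F])
    (y : F) :
  y ^+ p = y -> exists a, y = Fp_embed pcharFp a.
Proof.
move=> yp; have p_pr := pcharf_prime pcharFp.
have p_gt1 := prime_gt1 p_pr.
have [/codomP|y_notin] := boolP (y \in codom (Fp_embed pcharFp)); first by [].
have szP := size_XnsubX F p_gt1.
have /max_poly_roots : 'X^p - 'X != 0 :> {poly F} by rewrite -size_poly_eq0 szP.
move/(_ (y :: codom (Fp_embed pcharFp))); rewrite /= szP size_map -cardE.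
rewrite card_Fp // ltnn y_notin (map_inj_uniq (fmorph_inj _)) enum_uniq.
move=> H; suff: false by []; apply: H => //.
rewrite /root !hornerE yp subrr eqxx /=; apply/allP=> _ /codomP[a ->].
by rewrite /root !hornerE -rmorphXn Fp_expp ?subrr.
Qed.

(** * The trace from F_{p^2} to F_p *)

Section Trace.

Variables (F : finFieldType) (p : nat).
Hypotheses (pcharFp : p \in [pchar F]) (cardF : #|F| = (p ^ 2)%N).

Let p_pr : prime p := pcharf_prime pcharFp.

Lemma exprDp (x y : F) : (x + y) ^+ p = x ^+ p + y ^+ p.
Proof. by rewrite exprDn_pchar // pnatE. Qed.

Lemma expr_sump (T : finType) (g : T -> F) :
  (\sum_x g x) ^+ p = \sum_x g x ^+ p.
Proof. by rewrite -(pFrobenius_autE pcharFp) rmorph_sum. Qed.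

Lemma exprpp (x : F) : (x ^+ p) ^+ p = x.
Proof. by rewrite -exprM mulnn -cardF expf_card. Qed.

Lemma trace_eq0 (a : F) : (forall x, a * x + (a * x) ^+ p = 0) -> a = 0.
Proof.
move=> tr0; have p_gt1 := prime_gt1 p_pr.
have /(congr1 (coefp 1)) : a *: 'X + a ^+ p *: 'X^p = 0 :> {poly F}.
  apply: poly_vanish_finField => [|x]; last by rewrite !hornerE -exprMn.
  rewrite cardF (leq_trans (size_polyD _ _)) // geq_max.
  rewrite !(leq_trans (size_scale_leq _ _)) ?size_polyX ?size_polyXn //; nia.
rewrite /= !coefE /= (ltn_eqF p_gt1) mulr1 mulr0 addr0 //.
Qed.

Lemma trace_exists : exists tr : F -> 'F_p,
  (forall x, Fp_embed pcharFp (tr x) = x + x ^+ p)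
  /\ {morph tr : x y / x + y}.
Proof.
have /fin_all_exists[tr trE] x : exists a, x + x ^+ p = Fp_embed pcharFp a.
  by apply: Fp_embed_fixed; rewrite exprDp exprpp addrC.
exists tr; split=> [x|x y]; first by rewrite trE.
by apply: (fmorph_inj (Fp_embed pcharFp));
  rewrite rmorphD /= -!trE exprDp addrACA.
Qed.

End Trace.

Section Moments.

Variables (F : finFieldType) (p : nat).
Hypotheses (pcharFp : p \in [pchar F]) (cardF : #|F| = (p ^ 2)%N).
Hypothesis p_odd : odd p.

Let p_pr : prime p := pcharf_prime pcharFp.
Let p_gt2 : (2 < p)%N := odd_prime_gt2 p_odd p_pr.

(** A derivative of this function is the trace of a permutation of F, so its character sum is that
    of the nonzero additive map [tr]. *)
Lemma planar_trace_bent (f : F -> F) (tr : F -> 'F_p) (a b : F) :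
    (forall x, Fp_embed pcharFp (tr x) = x + x ^+ p) ->
    {morph tr : x y / x + y} ->
    planar f -> a != 0 ->
  bent (fun x => tr (a * f x + b * x)).
Proof.
move=> trE trD f_planar a0 z u z_prim u0.
have trB x y : tr (x - y) = tr x - tr y.
  by apply: (addIr (tr y)); rewrite subrK -trD subrK.
pose phi x := a * (f (x + u) - f x - f u) + (a * f u + b * u).
have phi_inj : injective phi.
  by move=> x y /addIr/(mulfI a0); apply: (bij_inj (f_planar u u0)).
have [y tr_y] : exists y, tr y != 0.
  apply/existsP; apply: contraT; rewrite negb_exists => /forallP tr0.
  have /eqP := oner_neq0 F; case; apply: (trace_eq0 pcharFp cardF) => x.
  by rewrite mul1r -trE; move: (tr0 x); rewrite negbK => /eqP->;
    rewrite rmorph0.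
rewrite (eq_bigr (fun x => z ^+ tr (phi x))) => [|x _]; last first.
  by rewrite -trB; congr (z ^+ nat_of_ord (tr _)); rewrite /phi; ring.
transitivity (\sum_x z ^+ tr x); first by rewrite [RHS](reindex_inj phi_inj).
exact: sum_unity_additive tr_y.
Qed.

(** The power sums of Tr(a f(x)) + c Tr(b x) of degree p - 2 vanish for all c in F_p; the
    coefficient of c^(p-3) says that a times the present sum has trace 0. As a is arbitrary, the sum
    is 0. *)
Lemma trace_moment (f : F -> F) (b : F) :
  planar f -> \sum_x f x * (b * x + (b * x) ^+ p) ^+ (p - 3) = 0.
Proof.
move=> f_planar; have [tr [trE trD]] := trace_exists pcharFp cardF.
have trZ (c : 'F_p) x : tr (Fp_embed pcharFp c * x) = c * tr x.
  apply: (fmorph_inj (Fp_embed pcharFp)); rewrite rmorphM /= !trE mulrDr exprMn.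
  by rewrite -rmorphXn Fp_expp.
apply: (trace_eq0 pcharFp cardF) => a; rewrite mulrC.
have [->|a0] := eqVneq a 0;
  first by rewrite mul0r expr0n (gtn_eqF (prime_gt0 p_pr)) addr0.
have sum0 :
    \sum_x tr (a * f x) ^+ (p - 2 - (p - 3)) * tr (b * x) ^+ (p - 3) = 0.
  apply: mixed_power_sum => //; try lia; move=> c.
  rewrite -[RHS](@bent_power_sum F p 2 (p - 2)
    (fun x => tr (a * f x + Fp_embed pcharFp c * b * x))) //.
  - by apply: eq_bigr => x _; rewrite trD -mulrA trZ.
  - exact: planar_trace_bent.
  - lia.
  - lia.
have := congr1 (Fp_embed pcharFp) sum0; rewrite rmorph0 rmorph_sum /= => sum0';
  rewrite -[RHS]sum0'.
rewrite mulr_sumr (expr_sump pcharFp) -big_split; apply: eq_bigr => x _ /=.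
rewrite rmorphM !rmorphXn /= !trE (_ : p - 2 - (p - 3) = 1)%N; last by lia.
have Tp : (b * x + (b * x) ^+ p) ^+ p = b * x + (b * x) ^+ p.
  by rewrite (exprDp pcharFp) (exprpp cardF) addrC.
by rewrite expr1 mulrA [(_ * _ ^+ (p - 3)) ^+ p]exprMn exprAC Tp mulrDl.
Qed.

(** Expand [trace_moment] as a polynomial in b: the exponents p - 3 + (p-1)i are distinct and below
    p^2, so each coefficient vanishes. *)
Lemma moment_eq0 (f : F -> F) (s : nat) :
  planar f -> (s <= p - 3)%N -> \sum_x f x * x ^+ (p - 3 + p.-1 * s) = 0.
Proof.
move=> f_planar le_s; pose n := (p - 3)%N; pose e i := (n + p.-1 * i)%N.
pose c i := 'C(n, i)%:R * \sum_x f x * x ^+ e i.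
have e_inj : injective e by move=> i j; rewrite /e => /addnI; nia.
have /(congr1 (coefp (e s))) : \sum_(i < n.+1) c i *: 'X^(e i) = 0.
  apply: poly_vanish_finField => [|b].
    apply: (leq_trans (size_sum _ _ _)); apply/bigmax_leqP => i _.
    rewrite (leq_trans (size_scale_leq _ _)) // size_polyXn cardF.
    by have := ltn_ord i; rewrite /e /n; nia.
  rewrite horner_sum -[RHS](trace_moment b f_planar).
  under [RHS]eq_bigr => x _ do rewrite exprDn mulr_sumr.
  rewrite exchange_big; apply: eq_bigr => i _.
  rewrite !hornerE /c mulrAC mulr_sumr; apply: eq_bigr => x _.
  rewrite -mulr_natl -exprM -exprD exprMn.
  have -> : (p - 3 - i + p * i = e i)%N.
    by have := ltn_ord i; rewrite /e /n; nia.
  by ring.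
rewrite /= coef_sum coef0.
rewrite (bigD1 (Ordinal (le_s : s < n.+1)%N)) //= big1 => [|i ne_i]; last first.
  rewrite coefZ coefXn (inj_eq e_inj) eq_sym.
  by move: ne_i; rewrite -val_eqE /= => /negPf->; rewrite mulr0.
rewrite addr0 coefZ coefXn eqxx mulr1 => /eqP;
  rewrite mulf_eq0 => /orP[|/eqP//].
have n_ltp : (n < p)%N by rewrite /n; lia.
have := natr_bin_Fp_neq0 p_pr n_ltp le_s.
by rewrite -(fmorph_eq0 (Fp_embed pcharFp)) /= Fp_embed_nat => /negPf->.
Qed.

Lemma Fp_exp_neq1 (e : nat) :
  ~~ (p.-1 %| e)%N -> exists2 c : 'F_p, c != 0 & c ^+ e != 1.
Proof.
move=> ndvd; pose r := (e %% p.-1)%N.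
have r_lt : (r < p.-1)%N by rewrite ltn_mod; lia.
have r_gt0 : (0 < r)%N by rewrite lt0n.
have cX (c : 'F_p) : c != 0 -> c ^+ e = c ^+ r.
  move=> c0; rewrite {1}(divn_eq e p.-1) exprD mulnC exprM Fp_expN1 //.
  by rewrite expr1n mul1r.
suff: [exists c : 'F_p, (c != 0) && (c ^+ e != 1)].
  by case/existsP=> c /andP[]; exists c.
apply: contraT; rewrite negb_exists => /forallP all1.
have szP : size ('X^r - 1 : {poly 'F_p}) = r.+1 by rewrite size_XnsubC.
suff /eqP : 'X * ('X^r - 1) = 0 :> {poly 'F_p}.
  by rewrite mulf_eq0 polyX_eq0 -size_poly_eq0 szP.
apply: poly_vanish_finField => [|c].
  rewrite card_Fp // mulrC size_mulX -?size_poly_eq0 szP //; lia.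
rewrite !hornerE; have [->|c0] := eqVneq c 0; first by rewrite mul0r.
by move: (all1 c); rewrite c0 negbK cX // => /eqP->; rewrite subrr mulr0.
Qed.

(** Substituting c x for x multiplies the moment by c^(k+2), which differs from 1 for some nonzero
    c. *)
Lemma homogeneous_moment_eq0 (f : F -> F) (k : nat) :
    (forall (c : 'F_p) x, f (Fp_embed pcharFp c * x) =
      Fp_embed pcharFp c ^+ 2 * f x) ->
    ~~ (p.-1 %| k + 2)%N ->
  \sum_x f x * x ^+ k = 0.
Proof.
move=> fZ /Fp_exp_neq1[c c0 c_neq1].
have i0 : Fp_embed pcharFp c != 0 by rewrite fmorph_eq0.
have : \sum_x f x * x ^+ k
    = Fp_embed pcharFp (c ^+ (k + 2)) * \sum_x f x * x ^+ k.
  rewrite {1}(reindex_inj (mulfI i0)) mulr_sumr; apply: eq_bigr => x _.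
  by rewrite fZ exprMn addnC rmorphXn exprD /=; ring.
move/eqP; rewrite -subr_eq0 -{1}[X in X - _]mul1r
  -mulrBl mulf_eq0 subr_eq0 eq_sym.
by rewrite fmorph_eq1 (negPf c_neq1) => /eqP.
Qed.

(** The geometric sum [kernel] detects y <> x: times x - y it is x^q - y^q = x - y, and on the
    diagonal it is q x^(q-1) = 0, with q = #|F|. *)
Lemma finField_interpolation (f : F -> F) (x : F) :
  f x = \sum_y f y - \sum_(i < #|F|) x ^+ (#|F|.-1 - i) * \sum_y f y * y ^+ i.
Proof.
have kernel (y : F) : \sum_(i < #|F|) x ^+ (#|F|.-1 - i) * y ^+ i = (y != x)%:R.
  have [->|ne_yx] := eqVneq y x.
    rewrite (eq_bigr (fun=> x ^+ #|F|.-1)) => [|i _]; last first.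
      by rewrite -exprD subnK // -ltnS prednK ?ltn_ord // cardF; nia.
    by rewrite sumr_const card_ord cardF -[LHS]mulr_natl
      -mulnn natrM (pcharf0 pcharFp) !mul0r.
  have /mulfI : x - y != 0 by rewrite subr_eq0 eq_sym.
  by apply; rewrite -subrXX !expf_card mulr1.
transitivity (\sum_y f y * (1 - (y != x)%:R)).
  rewrite (bigD1 x) //= eqxx subr0 mulr1 big1 ?addr0 // => y ->.
  by rewrite subrr mulr0.
under eq_bigr => y _ do rewrite mulrBr mulr1.
rewrite sumrB; congr (_ - _).
under eq_bigr => y _ do rewrite -kernel mulr_sumr.
rewrite exchange_big; apply: eq_bigr => i _; rewrite mulr_sumr.
by apply: eq_bigr => y _; ring.
Qed.

Lemma planar_homogeneous_quadratic (f : F -> F) :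
    planar f ->
    (forall (c : 'F_p) x, f (Fp_embed pcharFp c * x) =
      Fp_embed pcharFp c ^+ 2 * f x) ->
  exists a b c, forall x, f x = a * x ^+ 2 + b * x ^+ p.+1 + c * x ^+ (2 * p).
Proof.
move=> f_planar fZ; pose M i := \sum_y f y * y ^+ i.
have f0 : f 0 = 0.
  have := fZ 0 0; rewrite rmorph0 mul0r => ->; by rewrite expr0n mul0r.
pose q := #|F|; have q_p : q = (p * p)%N by rewrite /q cardF mulnn.
have M0 : M 0%N = 0.
  (* For p = 3 homogeneity says nothing at index 0, as p - 1 divides 2. *)
  have [p3|p_neq3] := eqVneq p 3.
    by have := @moment_eq0 f 0 f_planar (leq0n _); rewrite p3.
  apply: homogeneous_moment_eq0 => //; rewrite add0n gtnNdvd //; lia.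
have Mq : M q.-1 = 0.
  rewrite -M0; apply: eq_bigr => y _; have [->|y0] := eqVneq y 0.
    by rewrite f0 !mul0r.
  congr (_ * _); rewrite expr0; apply: (mulfI y0).
  by rewrite -exprS prednK ?expf_card ?mulr1 // q_p; nia.
(* If i + 2 = m(p - 1), then 0 < m <= p + 1; [moment_eq0] covers m <= p - 2. The exceptions m = p +
   1, p, p - 1 leave the monomials of degree q - 1 - i = 2, p + 1, 2p. *)
have M_eq0 i : (i < q.-1)%N -> i != (q - 3)%N -> i != (q - p - 2)%N ->
    i != (q - 2 * p - 1)%N -> M i = 0.
  move=> i_lt i1 i2 i3; have [/dvdnP[m def_m]|] := boolP (p.-1 %| i + 2)%N;
    last first.
    exact: homogeneous_moment_eq0.
  have m_lt : (m < p.+2)%N by nia.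
  have m1 : m != p.+1.
    by apply: contraNneq i1 => m_eq; move: def_m; rewrite m_eq; nia.
  have m2 : m != p.
    by apply: contraNneq i2 => m_eq; move: def_m; rewrite m_eq; nia.
  have m3 : m != p.-1.
    by apply: contraNneq i3 => m_eq; move: def_m; rewrite m_eq; nia.
  have le_m : (m.-1 <= p - 3)%N by clear - m_lt m1 m2 m3 p_gt2; lia.
  have m_gt0 : (0 < m)%N by case: (m) def_m => //; rewrite mul0n addn2.
  have -> : i = (p - 3 + p.-1 * m.-1)%N.
    by move: def_m; rewrite -{1}(prednK m_gt0) mulSn mulnC; lia.
  exact: moment_eq0.
exists (- M (q - 3)%N), (- M (q - p - 2)%N), (- M (q - 2 * p - 1)%N) => x.
have delta k (g : nat -> F) :
    (k < q)%N -> \sum_(i < q) (i == k :> nat)%:R * g i = g k :> F.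
  move=> kq; rewrite (bigD1 (Ordinal kq)) //= eqxx mul1r big1 ?addr0 // => i.
  by rewrite -val_eqE /= => /negPf->; rewrite mul0r.
rewrite {1}(finField_interpolation f x) -/q.
pose g i := x ^+ (q.-1 - i) * M i.
have -> : \sum_y f y = 0.
  by rewrite -[RHS]M0; apply: eq_bigr => y _; rewrite mulr1.
have -> : \sum_(i < q) x ^+ (q.-1 - i) * M i =
    \sum_(i < q) ((i == (q - 3)%N :> nat)%:R * g i
       + (i == (q - p - 2)%N :> nat)%:R * g i
       + (i == (q - 2 * p - 1)%N :> nat)%:R * g i).
  apply: eq_bigr => i _; rewrite -/(g i) -!mulrDl.
  have [i_eq|i_ne] := eqVneq (i : nat) q.-1; first by rewrite /g i_eq Mq !mulr0.
  have i_lt : (i < q.-1)%N by have := ltn_ord i; lia.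
  have [i1|i1] := eqVneq (i : nat) (q - 3)%N.
    have [-> ->] : (i == (q - p - 2)%N :> nat) = false
        /\ (i == (q - 2 * p - 1)%N :> nat) = false.
      by split; nia.
    by rewrite !addr0 mul1r.
  have [i2|i2] := eqVneq (i : nat) (q - p - 2)%N.
    by rewrite (_ : (i == _ :> nat) = false) ?addr0 ?add0r ?mul1r //; nia.
  have [i3|i3] := eqVneq (i : nat) (q - 2 * p - 1)%N;
    first by rewrite !add0r mul1r.
  by rewrite /g M_eq0 // !mulr0.
have [k1 k2 k3] : [/\ q - 3 < q, q - p - 2 < q & q - 2 * p - 1 < q]%N.
  by split; nia.
have [n1 n2 n3] : [/\ q.-1 - (q - 3) = 2, q.-1 - (q - p - 2) = p.+1
    & q.-1 - (q - 2 * p - 1) = 2 * p]%N.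
  by split; nia.
rewrite !big_split /= !delta // /g n1 n2 n3.
by ring.
Qed.

End Moments.

(** * Quadratic planar functions *)

Section QuadraticPlanar.

Variables (F : finFieldType) (p : nat).
Hypotheses (pcharFp : p \in [pchar F]) (cardF : #|F| = (p ^ 2)%N).
Hypothesis p_odd : odd p.

Let p_pr : prime p := pcharf_prime pcharFp.
Let p_gt2 : (2 < p)%N := odd_prime_gt2 p_odd p_pr.

Local Notation iota := (Fp_embed pcharFp).

Lemma additive_Fp_scale (g : F -> F) (c : 'F_p) (x : F) :
  {morph g : x y / x + y} -> g (iota c * x) = iota c * g x.
Proof.
move=> gD; rewrite !mulr_natl; elim: (c : nat) => [|n IHn].
  by rewrite !mulr0n; apply: (addIr (g 0)); rewrite -gD !add0r.
by rewrite !mulrS gD IHn.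
Qed.

Lemma Fp_embed_expp (c : 'F_p) : iota c ^+ p = iota c.
Proof. by rewrite -rmorphXn Fp_expp. Qed.

Lemma exists_Frobenius_moved : exists u : F, u ^+ p != u.
Proof.
apply/existsP; apply: contraT; rewrite negb_exists => /forallP fixed.
have szP := size_XnsubX F (prime_gt1 p_pr).
suff /eqP : 'X^p - 'X = 0 :> {poly F} by rewrite -size_poly_eq0 szP.
apply: poly_vanish_finField => [|x]; first by rewrite szP cardF; nia.
by rewrite !hornerE; move: (fixed x); rewrite negbK => /eqP->; rewrite subrr.
Qed.

(** The coordinate (x - x^p) / (u - u^p) is fixed by Frobenius, which negates numerator and
    denominator. *)
Lemma Frobenius_basis (u x : F) : u ^+ p != u ->
  exists a b : 'F_p, x = iota a + iota b * u.
Proof.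
move=> u_moved; have d0 : u - u ^+ p != 0 by rewrite subr_eq0 eq_sym.
have subp (y z : F) : (y - z) ^+ p = y ^+ p - z ^+ p.
  by apply: (addIr (z ^+ p)); rewrite subrK -(exprDp pcharFp) subrK.
pose t := (x - x ^+ p) / (u - u ^+ p).
have [b t_b] : exists b, t = iota b.
  apply: Fp_embed_fixed; rewrite exprMn exprVn !subp !(exprpp cardF).
  by rewrite -(opprB x) -(opprB u) invrN mulrNN.
have [a s_a] : exists a, x - t * u = iota a.
  apply: Fp_embed_fixed; rewrite subp exprMn {1}t_b Fp_embed_expp -t_b.
  apply/eqP; rewrite -subr_eq0; apply/eqP.
  transitivity (t * (u - u ^+ p) - (x - x ^+ p)); first by ring.
  by rewrite divfK // subrr.
by exists a, b; rewrite -s_a -t_b subrK.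
Qed.

(** If c = z^i for a generator z of the unit group, c^(p-1) = 1 forces p + 1 to divide i, so i is
    even. This serves to solve quadratic equations over F_p in F. *)
Lemma Fp_embed_square (c : 'F_p) : exists r, iota c = r ^+ 2.
Proof.
have [->|c0] := eqVneq c 0; first by exists 0; rewrite rmorph0 expr0n.
have N_gt0 : (0 < #|F|.-1)%N by rewrite cardF; nia.
have unity (x : F) : x != 0 -> x ^+ #|F|.-1 = 1.
  move=> x0; apply: (mulfI x0).
  by rewrite -exprS prednK ?expf_card ?mulr1 // cardF; nia.
have /hasP[z _ z_prim] : has #|F|.-1.-primitive_root (enum (predC1 (0 : F))).
  apply: cyclic.has_prim_root; rewrite ?enum_uniq -?cardE ?cardC1 //.
  by apply/allP=> x; rewrite mem_enum => x0; apply/unity_rootP; apply: unity.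
have i0 : iota c != 0 by rewrite fmorph_eq0.
have [i def_c] := prim_rootP z_prim (unity _ i0).
suff i_even : ~~ odd i.
  by exists (z ^+ i./2); rewrite def_c -exprM muln2 even_halfK.
have: iota c ^+ p.-1 = 1 by rewrite -rmorphXn Fp_expN1 // rmorph1.
rewrite def_c -exprM => /eqP; rewrite -(prim_order_dvd z_prim).
move: (nat_of_ord i) => k;
  have -> : (#|F|.-1 = p.+1 * p.-1)%N by rewrite cardF; nia.
rewrite dvdn_pmul2r; last by lia.
by move/dvdnP=> [q ->]; rewrite oddM /= p_odd andbF.
Qed.

(** A polynomial a X + b X^p can be fitted to g at the basis 1, u; both sides are F_p-linear. *)
Lemma additive_linearized (g : F -> F) :
  {morph g : x y / x + y} ->
  exists L : {poly F}, linearized p L /\ forall x, L.[x] = g x.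
Proof.
move=> gD; have [u u_moved] := exists_Frobenius_moved.
have d0 : u ^+ p - u != 0 by rewrite subr_eq0.
pose b := (g u - g 1 * u) / (u ^+ p - u); pose a := g 1 - b.
pose L := \sum_(i < 2) (if i == ord0 then a else b) *: 'X^(p ^ i).
have LE x : L.[x] = a * x + b * x ^+ p.
  by rewrite /L big_ord_recl big_ord1 /= !hornerE ?expn0 ?expn1 ?expr1.
exists L; split=> [|x];
  first by exists 2, (fun i => if i == ord0 then a else b).
have [s [t ->]] := Frobenius_basis x u_moved.
rewrite LE (exprDp pcharFp) exprMn !Fp_embed_expp gD (additive_Fp_scale _ _ gD).
have -> : g (iota s) = iota s * g 1.
  by rewrite -(additive_Fp_scale _ _ gD) mulr1.
have bE : b * (u ^+ p - u) = g u - g 1 * u by rewrite divfK.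
transitivity (iota s * g 1 + iota t * (b * (u ^+ p - u) + g 1 * u)).
  by rewrite /a; ring.
by rewrite bE subrK.
Qed.

Lemma linearized_permutation (g g' : F -> F) :
    {morph g : x y / x + y} -> cancel g g' -> cancel g' g ->
  exists L : {poly F},
    [/\ linearized p L, permutation_poly L & forall x, L.[x] = g x].
Proof.
move=> gD gK g'K; have [L [L_lin LE]] := additive_linearized gD.
by exists L; split=> //; exists g' => x; rewrite LE ?gK ?g'K.
Qed.

Lemma cancel_additive (g g' : F -> F) :
    {morph g : x y / x + y} -> cancel g g' -> cancel g' g ->
  {morph g' : x y / x + y}.
Proof. by move=> gD gK g'K x y; rewrite -{1}[x]g'K -{1}[y]g'K -gD gK. Qed.

Lemma additive_inj_cancel (g : F -> F) :
    {morph g : x y / x + y} -> (forall x, g x = 0 -> x = 0) ->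
  exists2 g', cancel g g' & cancel g' g.
Proof.
move=> gD g_eq0; suff /injF_bij[g' gK g'K] : injective g by exists g'.
move=> x y eq_g; apply/eqP; rewrite -subr_eq0; apply/eqP; apply: g_eq0.
by apply: (addIr (g y)); rewrite -gD subrK eq_g add0r.
Qed.

Lemma quadratic_planar_equivalent_square (f : F -> F) (a b c : F) :
    planar f ->
    (forall x, f x = a * x ^+ 2 + b * x ^+ p.+1 + c * x ^+ (2 * p)) ->
  planar_equivalent p f (fun x => x ^+ 2).
Proof.
move=> f_planar f_quad.
have two_neq0 : 2%:R != 0 :> F by rewrite -(dvdn_pcharf pcharFp) gtnNdvd.
pose B x y := 2%:R * a * x * y + b * (x * y ^+ p + x ^+ p * y)
  + 2%:R * c * x ^+ p * y ^+ p.
have fE x : f x = a * x ^+ 2 + b * (x * x ^+ p) + c * (x ^+ p) ^+ 2.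
  by rewrite f_quad [x ^+ p.+1]exprS mulnC exprM.
have BE x y : f (x + y) - f y - f x = B x y.
  by rewrite !fE (exprDp pcharFp) /B; ring.
have Bxx x : B x x = 2%:R * f x by rewrite fE /B; ring.
have BC x y : B x y = B y x by rewrite /B; ring.
have BD y : {morph B^~ y : x x' / x + x'}.
  by move=> x x'; rewrite /B (exprDp pcharFp); ring.
have B_eq0 x y : y != 0 -> B x y = 0 -> x = 0.
  move=> y0; have f0 : f 0 = 0.
    by rewrite fE [0 ^+ p]expr0n (gtn_eqF (prime_gt0 p_pr)) mulr0n; ring.
  have B0 : B 0 y = 0 by rewrite -BE add0r subrr sub0r f0 oppr0.
  move=> Bxy0; apply: (bij_inj (f_planar y y0)) => /=.
  by rewrite ![_ - _ - f y]addrAC !BE Bxy0 B0.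
have [M' MK M'K] : exists2 M', cancel (B^~ 1) M' & cancel M' (B^~ 1).
  by apply: additive_inj_cancel => // x; apply: B_eq0; apply: oner_neq0.
have M'D : {morph M' : x y / x + y} by apply: cancel_additive MK M'K.
(* [op] is a product with identity 1 and without zero divisors, so that
   [op u u = s + t u] with X^2 - t X - s irreducible over F_p; sending u to a
   root v in F of this polynomial turns [op] into the product of F. *)
pose op x y := M' (B x y).
have opDl y : {morph op^~ y : x x' / x + x'} by move=> x x'; rewrite /op BD M'D.
have opC x y : op x y = op y x by rewrite /op BC.
have op1 x : op x 1 = x by apply: MK.
have op_iotal r x y : op (iota r * x) y = iota r * op x y.
  exact: (additive_Fp_scale r x (opDl y)).
have op_iota r x : op (iota r) x = iota r * x.
  by rewrite -[iota r]mulr1 op_iotal opC op1 mulr1.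
have op_eq0 x y : y != 0 -> op x y = 0 -> x = 0.
  move=> y0 opxy0; apply: (B_eq0 x y y0).
  have M'0 : M' 0 = 0 by apply: (addIr (M' 0)); rewrite -M'D !add0r.
  by rewrite -[B x y]M'K -/(op x y) opxy0 -M'0 M'K.
have [u u_moved] := exists_Frobenius_moved.
have [s [t uu]] := Frobenius_basis (op u u) u_moved.
(* A root r would make u - r and u + r - t zero divisors for [op]. *)
have no_root (r : 'F_p) : r ^+ 2 != t * r + s.
  apply/eqP=> root_r.
  have ne0 (e : 'F_p) : u + iota e != 0.
    apply: contraNneq u_moved => /eqP; rewrite addr_eq0 -rmorphN => /eqP->.
    by rewrite Fp_embed_expp.
  have /eqP := ne0 (- r); apply; apply: (op_eq0 _ (u + iota (r - t)) (ne0 _)).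
  rewrite opDl op_iota opC opDl op_iota uu.
  transitivity (iota (t * r + s - r ^+ 2));
    last by rewrite -root_r subrr rmorph0.
  by rewrite !(rmorphD, rmorphN, rmorphM, rmorphXn) /=; ring.
have [v v_moved vv] : exists2 v : F, v ^+ p != v & v ^+ 2 = iota t * v + iota s.
  have [r def_r] := Fp_embed_square (t ^+ 2 + 4%:R * s).
  pose v := (iota t + r) / 2%:R; have vv : v ^+ 2 = iota t * v + iota s.
    apply: (mulfI (mulf_neq0 two_neq0 two_neq0)).
    have v2 : v * 2%:R = iota t + r by rewrite divfK.
    transitivity ((v * 2%:R) ^+ 2); first by ring.
    transitivity (2%:R * iota t * (v * 2%:R) + 4%:R * iota s); last by ring.
    rewrite v2.
    transitivity (iota t ^+ 2 + 2%:R * iota t * r + r ^+ 2); first by ring.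
    by rewrite -def_r rmorphD rmorphXn rmorphM rmorph_nat /=; ring.
  exists v => //; apply/eqP => v_fixed.
  have [e def_v] := Fp_embed_fixed pcharFp v_fixed.
  have /eqP := no_root e; apply; apply: (fmorph_inj iota).
  by rewrite rmorphXn rmorphD rmorphM /= -def_v.
have d0 : u ^+ p - u != 0 by rewrite subr_eq0.
(* [be] is chosen so that L fixes 1 and sends u to v. *)
pose be := (v - u) / (u ^+ p - u); pose L x := (1 - be) * x + be * x ^+ p.
have LD : {morph L : x y / x + y}.
  by move=> x y; rewrite /L (exprDp pcharFp); ring.
have Lu x y : L (iota x + iota y * u) = iota x + iota y * v.
  have bE : be * (u ^+ p - u) = v - u by rewrite divfK.
  rewrite /L (exprDp pcharFp) exprMn !Fp_embed_expp.
  transitivity (iota x + iota y * (be * (u ^+ p - u) + u)); first by ring.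
  by rewrite bE subrK.
have L_sq x : L (op x x) = L x ^+ 2.
  have [x1 [x2 ->]] := Frobenius_basis x u_moved.
  set y := iota x1 + _.
  have -> : op y y = iota (x1 ^+ 2 + x2 ^+ 2 * s)
      + iota (2%:R * x1 * x2 + x2 ^+ 2 * t) * u.
    rewrite /y opDl op_iota op_iotal opC opDl op_iota op_iotal uu.
    by rewrite !(rmorphD, rmorphM, rmorphXn, rmorph_nat) /=; ring.
  rewrite /y !Lu; transitivity (iota x1 ^+ 2 + 2%:R * iota x1 * iota x2 * v
      + iota x2 ^+ 2 * v ^+ 2); last by ring.
  by rewrite vv !(rmorphD, rmorphM, rmorphXn, rmorph_nat) /=; ring.
have [L' LK L'K] : exists2 L', cancel L L' & cancel L' L.
  apply: additive_inj_cancel => // x.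
  have [x1 [x2 ->]] := Frobenius_basis x u_moved; rewrite Lu => Lx0.
  have x2_0 : x2 = 0.
    apply/eqP; apply: contraNT v_moved => x2_neq0.
    have i0 : iota x2 != 0 by rewrite fmorph_eq0.
    have -> : v = iota (- x1 / x2).
      apply: (mulfI i0); rewrite -rmorphM /= [x2 * _]mulrC divfK //.
      by apply/eqP; rewrite rmorphN -addr_eq0 addrC Lx0.
    by rewrite Fp_embed_expp.
  by move: Lx0; rewrite x2_0 rmorph0 !mul0r.
have L'D : {morph L' : x y / x + y} by apply: cancel_additive LK L'K.
have [P1 [P1_lin P1_perm P1E]] := linearized_permutation L'D L'K LK.
(* Since B x x = 2 f x, g (f x) = L (op x x) = (L x)^2; precomposing with the inverse of L gives the
   square. *)
pose g x := L (M' (2%:R * x)).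
have gD : {morph g : x y / x + y} by move=> x y; rewrite /g mulrDr M'D LD.
have gK : cancel g (fun y => B (L' y) 1 / 2%:R).
  by move=> x; rewrite /g LK M'K mulrC mulKf.
have g'K : cancel (fun y => B (L' y) 1 / 2%:R) g.
  by move=> y; rewrite /g mulrC divfK // MK L'K.
have [P2 [P2_lin P2_perm P2E]] := linearized_permutation gD gK g'K.
exists P1, P2, 0, 0; split=> //.
  by exists 0%N, (fun=> 0); rewrite big_ord0.
by move=> x; rewrite P2E P1E horner0 !addr0 /g -Bxx -/(op _ _) L_sq L'K.
Qed.

End QuadraticPlanar.

(** * Reduction of the degree of homogeneity to 2, and conclusion *)

Lemma eq_Fp_expr_mod (p m n : nat) (x : 'F_p) :
    prime p -> (0 < m)%N -> (0 < n)%N -> m = n %[mod p.-1] ->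
  x ^+ m = x ^+ n.
Proof.
move=> p_pr m_gt0 n_gt0 eq_mn.
have [->|x0] := eqVneq x 0; first by rewrite !expr0n !gtn_eqF.
have modE k : x ^+ k = x ^+ (k %% p.-1).
  by rewrite {1}(divn_eq k p.-1) exprD mulnC exprM Fp_expN1 // expr1n mul1r.
by rewrite modE eq_mn -modE.
Qed.

Theorem theorem1p1 (p : nat) (F : finFieldType) (f : F -> F)
    (p_prime : prime p) (p_odd : odd p) (cardF : #|F| = (p ^ 2)%N)
    (f_planar : planar f) (f_homogeneous : homogeneous p f) :
  planar_equivalent p f (fun x : F => x ^+ 2).
Proof.
have pcharFp : p \in [pchar F] := card_finPcharP cardF p_prime.
have [d [d_gt0 fZ]] := f_homogeneous.
have fZe (c : 'F_p) x : f (Fp_embed pcharFp c * x) =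
  Fp_embed pcharFp c ^+ d * f x.
  exact: fZ.
(* On the prime field f is c^d f(1), so planarity in direction 1 makes c -> (c + 1)^d - c^d
   injective. *)
have d_mod : d = 2 %[mod p.-1].
  apply: planar_monomial_Fp => // x y /= eq_xy.
  apply: (fmorph_inj (Fp_embed pcharFp)).
  apply: (bij_inj (f_planar 1 (oner_neq0 F))) => /=.
  have delta (c : 'F_p) : f (Fp_embed pcharFp c + 1) - f (Fp_embed pcharFp c)
      = Fp_embed pcharFp ((c + 1) ^+ d - c ^+ d) * f 1.
    have -> : Fp_embed pcharFp c + 1 = Fp_embed pcharFp (c + 1) * 1.
      by rewrite rmorphD rmorph1 mulr1.
    have -> : f (Fp_embed pcharFp c) = Fp_embed pcharFp c ^+ d * f 1.
      by rewrite -fZe mulr1.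
    by rewrite fZe -mulrBl rmorphB !rmorphXn.
  by rewrite !delta eq_xy.
have [|a [b [c f_quad]]] :=
  @planar_homogeneous_quadratic F p pcharFp cardF p_odd f f_planar.
  by move=> c x; rewrite fZe -!rmorphXn (eq_Fp_expr_mod _ _ _ _ d_mod).
exact: (quadratic_planar_equivalent_square pcharFp cardF p_odd f_planar f_quad).
Qed.
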